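(* The vincular patterns $132\text{-}1$ and $132\text{-}2$ are Wilf-equivalent.
   Context: For $k\ge1$ let $[k]=\{1,\dots,k\}$; a $k$-ary word of length $n$ is an element of $[k]^n$. Two words are order-isomorphic if replacing the $i$-th smallest distinct letter by $i$ yields the same word. A vincular pattern $abc\text{-}d$ occurs in $w=w_1\cdots w_n$ if there are indices $p$ and $q\ge p+3$ with $w_pw_{p+1}w_{p+2}w_q$ order-isomorphic to $abcd$; otherwise $w$ avoids it. For a pattern $\sigma$, $a_\sigma(n,k)$ is the number of words in $[k]^n$ avoiding $\sigma$; $\sigma\sim\tau$ (Wilf-equivalence) means $a_\sigma(n,k)=a_\tau(n,k)$ for all $n\ge0,k\ge1$. *)

(* Defs.v *)
From mathcomp Require Import all_boot.

Set Implicit Arguments.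
Unset Strict Implicit.
Unset Printing Implicit Defensive.

Definition reduction (s : seq nat) : seq nat :=
  [seq (index x (sort leq (undup s))).+1 | x <- s].

Definition order_isomorphic (s t : seq nat) : bool := reduction s == reduction t.

(* A word in [k]^n is an n.-tuple 'I_k, the ordinal i standing for the letter
   i + 1; order-isomorphism is insensitive to this shift. Positions are numbered
   from 0. *)
Definition letter (n k : nat) (w : n.-tuple 'I_k) (i : 'I_n) : nat := tnth w i.

(* The vincular pattern abc-d is represented by the tuple (a, b, c, d). *)
Definition occurs_in (sigma : 4.-tuple nat) (n k : nat) (w : n.-tuple 'I_k)
    : bool :=
  [exists p : 'I_n, exists p1 : 'I_n, exists p2 : 'I_n, exists q : 'I_n,
    [&& p1 == p + 1 :> nat, p2 == p + 2 :> nat, p + 3 <= q &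
        order_isomorphic [:: letter w p; letter w p1; letter w p2; letter w q]
                         sigma]].

Definition avoids (sigma : 4.-tuple nat) (n k : nat) (w : n.-tuple 'I_k) : bool :=
  ~~ occurs_in sigma w.

Definition avoiders (sigma : 4.-tuple nat) (n k : nat) : nat :=
  #|[set w : n.-tuple 'I_k | avoids sigma w]|.

Definition wilf_equivalent (sigma tau : 4.-tuple nat) : Prop :=
  forall n k : nat, 1 <= k -> avoiders sigma n k = avoiders tau n k.

(* Main.v *)
Require Import Defs.
From mathcomp Require Import all_boot all_fingroup zify.

Set Implicit Arguments.
Unset Strict Implicit.
Unset Printing Implicit Defensive.

(**
Two consecutive occurrences of 132 overlap in at most one letter, so they
assemble into chains a_0 c_1 a_1 ... c_m a_m with a_0 < ... < a_m and
a_i < c_i. Words that avoid the pattern except possibly along an initial chain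
are counted by inclusion-exclusion from the pairs (chain, avoiding suffix u)
such that u contains a_0, ..., a_(m-1) (for 132-1) or a_1, ..., a_m (for 132-2).
The number of avoiding words whose set of letters is exactly S depends only on
#|S|, so exchanging a_0 and a_m in the letter set of u identifies the two
counts, by induction on the length and for each prescribed total letter set.
*)

(** * Order-isomorphism through ranks of letters *)

Lemma index_sort_ltn (s : seq nat) (x y : nat) : x \in s -> y \in s ->
  (index x (sort leq (undup s)) < index y (sort leq (undup s))) = (x < y).
Proof.
move=> xs ys; set t := sort leq (undup s).
have xt : x \in t by rewrite mem_sort mem_undup.
have yt : y \in t by rewrite mem_sort mem_undup.
have st : sorted ltn t.
  by rewrite ltn_sorted_uniq_leq sort_uniq undup_uniq (sort_sorted leq_total).
have H u v : u \in t -> v \in t -> index u t < index v t -> u < v.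
  move=> ut vt; exact: (sorted_ltn_index ltn_trans st u v ut vt).
case: (ltngtP x y) => [xy | yx | ->]; last by rewrite ltnn.
- case: ltngtP => // [/(H _ _ yt xt) | /(index_inj x xt yt)]; lia.
- apply/negP => /(H _ _ xt yt); lia.
Qed.

(** Equal reductions mean equal ranks position by position, and ranks compare as the letters do. *)
Lemma order_isomorphic_ltn (s t : seq nat) (i j : nat) :
  order_isomorphic s t -> i < size s -> j < size s ->
  (nth 0 s i < nth 0 s j) = (nth 0 t i < nth 0 t j).
Proof.
move=> /eqP st si sj.
have sz : size s = size t by have := congr1 size st; rewrite !size_map.
rewrite -(@index_sort_ltn s (nth 0 s i)) ?mem_nth //.
rewrite -(@index_sort_ltn t (nth 0 t i)) ?mem_nth -?sz //.
have H l : l < size s ->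
    index (nth 0 s l) (sort leq (undup s)) = index (nth 0 t l) (sort leq (undup t)).
  move=> sl; have := congr1 (fun r => nth 0 r l) st.
  by rewrite /reduction !(nth_map 0) -?sz // => -[].
by rewrite !H.
Qed.

Lemma sort_undup_eq (s t : seq nat) : sorted ltn t -> s =i t ->
  sort leq (undup s) = t.
Proof.
rewrite ltn_sorted_uniq_leq => /andP[ut st] eq_st.
apply: (sorted_eq leq_trans anti_leq) => //; first exact: sort_sorted leq_total _.
rewrite perm_sort; apply: uniq_perm => //; first exact: undup_uniq.
by move=> x; rewrite mem_undup.
Qed.

Lemma sum_tuple_cat (I : finType) a b (P : pred (seq I)) (F : seq I -> nat) :
  \sum_(w : (a + b).-tuple I | P w) F w
    = \sum_(p : a.-tuple I) \sum_(u : b.-tuple I | P (p ++ u)) F (p ++ u).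
Proof.
rewrite pair_big_dep /=.
rewrite (reindex (fun pu : a.-tuple I * b.-tuple I => [tuple of pu.1 ++ pu.2])) //=.
exists (fun w : (a + b).-tuple I => (tcast (minn_idPl (leq_addr b a)) [tuple of take a w],
                  tcast (addKn a b) [tuple of drop a w])).
  move=> [p u] _; congr (_, _); apply: val_inj; rewrite [LHS]val_tcast /=.
    by rewrite take_size_cat ?size_tuple.
  by rewrite drop_size_cat ?size_tuple.
by move=> w _; apply: val_inj; rewrite /= !val_tcast cat_take_drop.
Qed.

(* The boolean [r] selects the pattern: 132-1 for [true], 132-2 for [false]. *)
Definition pattern (r : bool) : 4.-tuple nat :=
  if r then [tuple 1; 3; 2; 1] else [tuple 1; 3; 2; 2].

Lemma order_isomorphic_pattern r a c b d :
  order_isomorphic [:: a; c; b; d] (pattern r)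
    = [&& a < b, b < c & d == if r then a else b].
Proof.
apply/idP/idP => [H | /and3P[ab bc /eqP->]].
  have Hn := order_isomorphic_ltn H.
  (* Positions 0, 2 and 2, 1 give a < b < c. That d repeats a letter follows below from the failure
     of both strict comparisons with it. *)
  have h02 := Hn 0 2 isT isT; have h21 := Hn 2 1 isT isT.
  case: r H Hn h02 h21 => /= _ Hn -> ->.
    have := Hn 0 3 isT isT; have /= := Hn 3 0 isT isT => /=.
    by case: ltngtP.
  have := Hn 2 3 isT isT; have /= := Hn 3 2 isT isT => /=.
  by case: ltngtP.
rewrite /order_isomorphic /reduction.
rewrite (@sort_undup_eq _ [:: a; b; c]) /= ?ab ?bc //; last first.
  by move=> x; rewrite !inE; case: r; do ![case: eqP].
have E x y : x < y -> (x == y) = false by move=> ?; apply/eqP; lia.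
have E' x y : x < y -> (y == x) = false by move=> ?; apply/eqP; lia.
by case: r; rewrite /= !eqxx !E ?E' ?eqxx //; lia.
Qed.

(** * Avoidance as a recursive condition on sequences *)

Section Words.

Variable k : nat.
Implicit Types (w u p : seq 'I_k) (r : bool) (S T : {set 'I_k}) (m n : nat).

(** The fourth letter repeats [a] or [b], so only its presence in the rest of the word matters, not
    its position. *)
Definition starts_occurrence r w : bool :=
  if w is a :: c :: b :: u then
    [&& a < b, b < c & (if r then a else b) \in u]
  else false.

Fixpoint avoiding r w : bool :=
  if w is x :: v then ~~ starts_occurrence r w && avoiding r v else true.

Lemma avoidingP r w :
  reflect (forall i, ~~ starts_occurrence r (drop i w)) (avoiding r w).
Proof.
elim: w => [|x v IH]; first by left; case.
apply: (iffP andP) => [[h /IH hv] [|i] | h]; rewrite ?drop0 //=.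
by split; [have := h 0; rewrite drop0 | apply/IH => i; have := h i.+1].
Qed.

Lemma avoids_pattern r n (w : n.-tuple 'I_k) :
  avoids (pattern r) w = avoiding r w.
Proof.
apply/idP/avoidingP => [/negP h i | h].
  apply/negP; case E: (drop i w) => [//|a [//|c [//|b u]]] /and3P[ab bc].
  set d := if r then a else b => du.
  have sz : n = i + (size u).+3.
    by have := congr1 size E; rewrite size_drop size_tuple /=; lia.
  have nthE j (lt : i + j < n) :
      tnth w (Ordinal lt) = nth a [:: a, c, b & u] j.
    by rewrite (tnth_nth a) /= -E nth_drop.
  have lt0 : i + 0 < n by lia.
  have lt1 : i + 1 < n by lia.
  have lt2 : i + 2 < n by lia.
  (* The fourth index is the first place of [d] in [u], shifted past the three adjacent letters. *)
  have ltq : i + (index d u).+3 < n by rewrite sz ltn_add2l !ltnS index_mem.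
  apply: h; apply/existsP; exists (Ordinal lt0); apply/existsP; exists (Ordinal lt1).
  apply/existsP; exists (Ordinal lt2); apply/existsP; exists (Ordinal ltq).
  rewrite order_isomorphic_pattern /letter !nthE /= nth_index // ab bc.
  rewrite !addn0 !eqxx leq_add2l /=.
  by rewrite /d; case: (r).
apply/negP => /existsP[p /existsP[p1 /existsP[p2 /existsP[q]]]].
case/and4P=> /eqP e1 /eqP e2 lq; rewrite order_isomorphic_pattern => /and3P[ab bc].
move=> /eqP dE.
have wE : drop p w = [:: tnth w p, tnth w p1, tnth w p2 & drop p.+3 w].
  have x0 := tnth w p; have szw := size_tuple w.
  have lp2 := ltn_ord p2; rewrite e2 in lp2.
  rewrite (drop_nth x0) ?szw; last lia.
  rewrite (drop_nth x0) ?szw; last lia.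
  rewrite (drop_nth x0) ?szw; last lia.
  by rewrite !(tnth_nth x0) e1 e2 addn1 addn2.
have /negP := h p; apply; rewrite wE /=; apply/and3P; split=> //.
have -> : (if r then tnth w p else tnth w p2) = tnth w q.
  by apply: val_inj; move: dE; rewrite /letter; case: (r) => /esym.
rewrite (tnth_nth (tnth w q)) -(subnKC lq) addn3 -nth_drop.
by apply: mem_nth; rewrite size_drop size_tuple; have := ltn_ord q; lia.
Qed.

(* After an occurrence a c b ..., the descent c b cannot start another one. *)
Lemma avoiding_behead r w : 0 < size w ->
  (avoiding r (behead w) : nat)
    = avoiding r w + (starts_occurrence r w && avoiding r (drop 2 w)).
Proof.
case: w => [//|a [|c [|b u]]] //= _.
case h: [&& a < b, b < c & _]; last by rewrite addn0.
case/and3P: h => _ bc _; case: u => [//|x u] /=.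
by have -> : (c < x) && ((x < b) && ((if r then c else x) \in u)) = false by lia.
Qed.

(** * Chains of overlapping occurrences *)

(** Occurrences start at positions 0, 2, ..., 2(m-1); the third letter of each is the first letter
    of the next. *)
Fixpoint chain r m w : bool :=
  if m is m'.+1 then starts_occurrence r w && chain r m' (drop 2 w) else true.

Lemma chainSr r m w :
  chain r m.+1 w = chain r m w && starts_occurrence r (drop m.*2 w).
Proof.
elim: m w => [|m IH] w; first by rewrite /= drop0 andbT.
rewrite [LHS]/= -/(chain r m.+1 (drop 2 w)) IH /= drop_drop andbA.
by rewrite doubleS addn2.
Qed.

Lemma chain_size r m w : chain r m.+1 w -> m.+1.*2 < size w.
Proof.
rewrite chainSr => /andP[_].
case E: (drop m.*2 w) => [//|a [//|c [//|b u]]] _.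
by have := congr1 size E; rewrite size_drop /=; lia.
Qed.

(** The order conditions alone, on exactly 2m+1 letters; the required repetitions are left to the
    suffix. *)
Fixpoint is_chain m p : bool :=
  if m is m'.+1 then
    if p is a :: c :: b :: q then [&& a < b, b < c & is_chain m' (b :: q)]
    else false
  else size p == 1.

(* The letters a_0, ..., a_m of a chain, at the even positions of [p]. *)
Fixpoint lows p : {set 'I_k} :=
  if p is a :: p' then a |: (if p' is c :: q then lows q else set0) else set0.

Lemma is_chain_gt m a p x : is_chain m (a :: p) -> x \in p -> a < x.
Proof.
elim: m a p => [|m IH] a [|c [|b q]] //= /and3P[ab bc h].
rewrite !inE => /or3P[/eqP->|/eqP->|xq]; [lia|lia|].
exact: ltn_trans ab (IH _ _ h xq).
Qed.

Lemma lows_last m a p : is_chain m (a :: p) -> last a p \in lows (a :: p).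
Proof.
elim: m a p => [|m IH] a [|c [|b q]] //=; rewrite ?inE ?eqxx //.
by case/and3P=> _ _ /IH; rewrite /= !inE => ->; rewrite orbT.
Qed.

Lemma mem_lows p x : x \in lows p -> x \in p.
Proof.
have [n] := ubnP (size p); elim: n p => // n IH [|a [|c q]] /= sz.
- by rewrite inE.
- by rewrite !inE orbF.
rewrite !inE => /orP[->//|xq]; rewrite IH ?orbT //; lia.
Qed.

(** Each fourth letter is some a_i. Within the chain all letters after a_i are larger, so the
    repetition must lie in [u]. The letters needed are a_0, ..., a_(m-1) for 132-1 and a_1, ..., a_m
    for 132-2. *)
Lemma chain_cat r m a p u : size p = m.*2 ->
  chain r m (a :: p ++ u) = is_chain m (a :: p) &&
    (lows (a :: p) :\ (if r then last a p else a) \subset [set x in u]).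
Proof.
elim: m a p => [|m IH] a [|c [|b q]] //=.
  move=> _; rewrite setU0; have -> : (if r then a else a) = a by case: r.
  by rewrite setDv sub0set.
move=> [sz]; rewrite IH //.
case ab: (a < b) => //=; case bc: (b < c) => //=.
case ch: (is_chain m (b :: q)); rewrite /= ?andbF //.
have gt x : x \in b :: q -> a < x.
  rewrite inE => /orP[/eqP->//|xq]; exact: ltn_trans ab (is_chain_gt ch xq).
have aL : a \notin lows (b :: q).
  by apply/negP => /mem_lows /gt; rewrite ltnn.
have aq : a \notin q.
  by apply/negP => aq; have := gt a; rewrite inE aq orbT ltnn => /(_ isT).
have bq : b \notin q.
  by apply/negP => /(is_chain_gt ch); rewrite ltnn.
case: r {IH}; rewrite mem_cat.
- rewrite (negPf aq) /= -[_ |: (if q is _ :: _ then _ else _)]/(lows (b :: q)).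
  have -> : (a |: lows (b :: q)) :\ last b q = a |: (lows (b :: q) :\ last b q).
    apply/setP => x; rewrite !inE; case: (x =P a) => [->|_] //=.
    by rewrite andbT; apply: contra aL => /eqP->; exact: lows_last ch.
  by rewrite subUset sub1set inE.
- rewrite (negPf bq) /= -[_ |: (if q is _ :: _ then _ else _)]/(lows (b :: q)).
  have bL : b \in lows (b :: q) by rewrite /= !inE eqxx.
  rewrite [in RHS]setU1K // -[in RHS](setD1K bL).
  by rewrite subUset sub1set inE.
Qed.

(** * Avoiding words with a prescribed letter set *)

Definition avoiders_on r n S : nat :=
  #|[set w : n.-tuple 'I_k | avoiding r w && ([set x in w] == S)]|.

Lemma increasing_inj (f : 'I_k -> 'I_k) (A : {pred 'I_k}) :
  {in A &, forall x y, (f x < f y) = (x < y)} -> {in A &, injective f}.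
Proof.
move=> mono x y xA yA fxy; apply: val_inj; have := mono x y xA yA.
by have := mono y x yA xA; rewrite fxy ltnn /=; case: ltngtP.
Qed.

Lemma avoiding_map r (f : 'I_k -> 'I_k) w :
  {in w &, forall x y, (f x < f y) = (x < y)} ->
  avoiding r (map f w) = avoiding r w.
Proof.
elim: w => [//|a v IH] mono /=; rewrite IH; last first.
  by move=> x y xv yv; apply: mono; rewrite inE ?xv ?yv orbT.
congr (~~ _ && _); case: v mono {IH} => [|c [|b u]] //= mono.
rewrite !mono ?inE ?eqxx ?orbT //; do 2 congr (_ && _).
have inj := increasing_inj mono.
have -> : (if r then f a else f b) = f (if r then a else b) by case: r.
set d := if r then a else b.
have dv : d \in [:: a, c, b & u] by rewrite /d; case: (r); rewrite !inE eqxx ?orbT.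
apply/mapP/idP => [[y yu /inj ->//]|]; last by exists d.
by rewrite !inE yu !orbT.
Qed.

Lemma increasing_transfer S T : #|S| = #|T| ->
  exists f : 'I_k -> 'I_k,
    {in S &, forall x y, (f x < f y) = (x < y)} /\ f @: S = T.
Proof.
(* The i-th smallest element of [S] goes to the i-th smallest of [T]; outside [S] the default makes
   [f] the identity. *)
move=> eqST; pose f x := nth x (enum T) (index x (enum S)).
have srt (A : {set 'I_k}) : sorted (relpre val ltn) (enum A).
  rewrite /enum_mem; apply: sorted_filter.
    by move=> y x z /=; exact: ltn_trans.
  by rewrite -enumT -sorted_map val_enum_ord iota_ltn_sorted.
have tr : transitive (relpre (@nat_of_ord k) ltn).
  by move=> y x z /=; exact: ltn_trans.
have ltT x : x \in S -> index x (enum S) < size (enum T).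
  by move=> xS; rewrite -cardE -eqST cardE index_mem mem_enum.
have incr x y : x \in S -> y \in S -> x < y -> f x < f y.
  move=> xS yS xy; rewrite /f [nth y _ _](set_nth_default x) ?ltT //.
  apply: (sorted_ltn_nth tr x (srt T)); rewrite ?inE ?ltT //.
  have xE : x \in enum S by rewrite mem_enum.
  have yE : y \in enum S by rewrite mem_enum.
  case: ltngtP => // [/(sorted_ltn_index tr (srt S) y x yE xE) /= | /(index_inj x xE yE) E].
    by move: xy; case: ltngtP.
  by move: xy; rewrite E ltnn.
have mono : {in S &, forall x y, (f x < f y) = (x < y)}.
  move=> x y xS yS; case: (ltngtP x y) => [/(incr _ _ xS yS) //|yx|/val_inj->].
    by have := incr _ _ yS xS yx; case: ltngtP.
  by rewrite ltnn.
exists f; split=> //; apply/eqP; rewrite eqEcard; apply/andP; split.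
  by apply/subsetP => _ /imsetP[x xS ->]; rewrite -mem_enum mem_nth ?ltT.
by rewrite card_in_imset ?eqST //; exact: increasing_inj mono.
Qed.

(** Relabelling letters along the increasing bijection from [S] to [T] is injective on words over
    [S] and preserves avoidance. *)
Lemma avoiders_on_le r n S T : #|S| = #|T| ->
  avoiders_on r n S <= avoiders_on r n T.
Proof.
case/increasing_transfer => f [mono fST].
have inj := increasing_inj mono.
pose A := [set w : n.-tuple 'I_k | avoiding r w && ([set x in w] == S)].
have AS (w : n.-tuple 'I_k) x : w \in A -> x \in tval w -> x \in S.
  by rewrite inE => /andP[_ /eqP<-]; rewrite inE.
rewrite /avoiders_on -/A -(@card_in_imset _ _ (map_tuple f) A).
  apply/subset_leq_card/subsetP => _ /imsetP[w wA ->]; rewrite inE /=.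
  rewrite avoiding_map; last by move=> x y xw yw; apply: mono; apply: AS wA _.
  move: (wA); rewrite inE => /andP[-> /eqP wS] /=.
  apply/eqP; rewrite -fST -wS; apply/setP => y; rewrite inE.
  apply/mapP/imsetP => -[x xw ->]; exists x => //; first by rewrite inE.
  by move: xw; rewrite inE.
move=> w v wA vA /(congr1 val) /= E; apply: val_inj => /=.
apply: (@inj_in_map _ _ f S) E => //.
all: by apply/allP => x; apply: AS.
Qed.

Lemma avoiders_on_card r n S T : #|S| = #|T| ->
  avoiders_on r n S = avoiders_on r n T.
Proof. by move=> ST; apply/eqP; rewrite eqn_leq !avoiders_on_le. Qed.

(** * Inclusion-exclusion along the initial chain *)

(** Avoidance is required from a_m on, so m = 0 gives the avoiding words. In [chain_tail_avoiding]
    it is required only after a_m, which separates the suffix from the chain. *)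
Definition chain_avoiding r m n T : nat :=
  \sum_(w : n.-tuple 'I_k | [set x in w] == T)
    (chain r m w && avoiding r (drop m.*2 w)).

Definition chain_tail_avoiding r m n T : nat :=
  \sum_(w : n.-tuple 'I_k | [set x in w] == T)
    (chain r m w && avoiding r (drop m.*2.+1 w)).

(** Either no occurrence starts at a_m, or one does and lengthens the chain by two letters. *)
Lemma chain_tail_avoidingE r m n T : m.*2 < n ->
  chain_tail_avoiding r m n T
    = chain_avoiding r m n T + chain_avoiding r m.+1 n T.
Proof.
move=> mn; rewrite -big_split /=; apply: eq_bigr => w _.
rewrite -/(chain r m.+1 w) chainSr; case: (chain r m w) => //=.
rewrite -[_.+1]add1n -drop_drop drop1 avoiding_behead ?size_drop ?size_tuple ?subn_gt0 //.
by rewrite drop_drop doubleS add2n.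
Qed.

(** * Exchange of the first and last low letters *)

(** For a fixed prefix, the suffixes are grouped by their letter set [S], on which alone the chain
    condition depends. *)
Lemma sum_suffix_letters r m n T a p : size p = m.*2 ->
  \sum_(u : n.-tuple 'I_k | [set x in a :: p ++ u] == T)
     (chain r m (a :: p ++ u) && avoiding r u)
  = \sum_(S | (S :|: [set x in a :: p] == T) &&
              (is_chain m (a :: p) &&
               (lows (a :: p) :\ (if r then last a p else a) \subset S)))
       avoiders_on r n S.
Proof.
have catE u : [set x in a :: p ++ u] = [set x in u] :|: [set x in a :: p].
  by apply/setP => x; rewrite !inE mem_cat orbA [RHS]orbC.
move=> sz; rewrite (partition_big (fun u : n.-tuple 'I_k => [set x in u]) xpredT) //=.
rewrite [RHS]big_mkcond; apply: eq_bigr => S _.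
rewrite /avoiders_on -sum1dep_card.
case: ifP => [/andP[/eqP TE h] | h].
- rewrite [RHS]big_mkcond [LHS]big_mkcond; apply: eq_bigr => u _.
  rewrite chain_cat //.
  have [uS|] := eqVneq [set x in u] S; last by rewrite !andbF.
  rewrite uS h !andbT.
  rewrite catE uS TE eqxx /=.
  by case: (avoiding r u).
- apply: big1 => u /andP[/eqP TE /eqP uS]; rewrite chain_cat // uS.
  apply/eqP; rewrite eqb0; apply/negP => /andP[h' _].
  move: h; rewrite h' andbT -TE -uS => /eqP; apply.
  by apply/setP => x; rewrite !inE mem_cat orbC orbA.
Qed.

Lemma tperm_imset S x y : x \in S -> y \in S -> tperm x y @: S = S.
Proof.
move=> xS yS; apply: im_perm_on; apply/subsetP => z; rewrite inE.
by case: tpermP => [->|->|_ _] //; rewrite eqxx.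
Qed.

(** The transposition of a_0 and a_m permutes the sets [S], keeps their cardinality, and turns one
    containment condition into the other. *)
Lemma sum_suffix_letters_eq m n T a p :
  (forall S, avoiders_on true n S = avoiders_on false n S) ->
  \sum_(S | (S :|: [set x in a :: p] == T) &&
            (is_chain m (a :: p) && (lows (a :: p) :\ last a p \subset S)))
       avoiders_on true n S
  = \sum_(S | (S :|: [set x in a :: p] == T) &&
              (is_chain m (a :: p) && (lows (a :: p) :\ a \subset S)))
       avoiders_on false n S.
Proof.
move=> IH; pose t := tperm a (last a p).
rewrite [RHS](reindex_inj (imset_inj (@perm_inj _ t))) /=.
apply: eq_big => [S|S _]; last first.
  by rewrite IH; apply: avoiders_on_card; rewrite card_imset //; exact: perm_inj.
case ch: (is_chain m (a :: p)); rewrite ?andbF //=.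
have aL : a \in [set x in a :: p] by rewrite inE mem_head.
have zL : last a p \in [set x in a :: p] by rewrite inE mem_last.
(* Both exchanged letters lie in the prefix, so the total letter set is unchanged. *)
congr (_ && _).
  rewrite -[in RHS](tperm_imset aL zL) -imsetU tperm_imset //.
    by rewrite in_setU aL orbT.
  by rewrite in_setU zL orbT.
rewrite -/(lows (a :: p)).
have aE : a \in lows (a :: p) by rewrite /= !inE eqxx.
have zE := lows_last ch.
have -> : lows (a :: p) :\ a = t @: (lows (a :: p) :\ last a p).
  apply/setP => y; rewrite -[in RHS](tpermK a (last a p) y).
  rewrite mem_imset; last exact: perm_inj.
  rewrite [LHS]in_setD1 [RHS]in_setD1; congr (_ && _).
    by rewrite -(inj_eq (@perm_inj _ t)) /t tpermK tpermR.
  rewrite -[in RHS](tperm_imset aE zE) mem_imset //; exact: perm_inj.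
apply/idP/idP; first exact: imsetS.
move=> h; apply/subsetP => x xA.
have /imsetP[y yS /perm_inj ->//] : t x \in t @: S.
by apply: (subsetP h); exact: imset_f.
Qed.

Lemma chain_tail_avoiding_eq m n T :
  (forall S, avoiders_on true n S = avoiders_on false n S) ->
  chain_tail_avoiding true m (m.*2.+1 + n) T
    = chain_tail_avoiding false m (m.*2.+1 + n) T.
Proof.
have splitE r : chain_tail_avoiding r m (m.*2.+1 + n) T
  = \sum_(p : m.*2.+1.-tuple 'I_k)
      \sum_(u : n.-tuple 'I_k | [set x in p ++ u] == T)
        (chain r m (p ++ u) && avoiding r u).
  rewrite /chain_tail_avoiding (sum_tuple_cat _ _ (fun w : seq _ => [set x in w] == T)
    (fun w => nat_of_bool (chain r m w && avoiding r (drop m.*2.+1 w)))).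
  apply: eq_bigr => p _; apply: eq_bigr => u _.
  by rewrite drop_size_cat ?size_tuple.
move=> IH; rewrite !splitE; apply: eq_bigr => -[p sz] _ /=.
case: p sz => [//|a p] /= sz; have {}sz : size p = m.*2 by apply/eqP.
by rewrite !sum_suffix_letters // sum_suffix_letters_eq.
Qed.

(** * Induction on length and summation over letter sets *)

Lemma avoiders_on_chain r n T : avoiders_on r n T = chain_avoiding r 0 n T.
Proof.
rewrite /avoiders_on -sum1dep_card /chain_avoiding big_mkcond [RHS]big_mkcond.
apply: eq_bigr => w _ /=; rewrite drop0 andbC.
by case: (_ == T); case: (avoiding r w).
Qed.

Lemma chain_avoiding_eq m n T :
  (forall n' S, n' < n -> avoiders_on true n' S = avoiders_on false n' S) ->
  chain_avoiding true m n T = chain_avoiding false m n T.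
Proof.
(* Descending induction on m, starting where the word is too short for a chain. *)
move=> IH; have [d] := ubnP (n - m.*2); elim: d m => // d IHd m hd.
have [nm | mn] := leqP n m.*2.
  (* For m = 0 only the empty word remains, which avoids both patterns; otherwise neither pattern
     admits an m-chain. *)
  apply: eq_bigr => w _; case: m nm {hd} => [|m] nm.
    by have := size_tuple w; case: (tval w) => //=; lia.
  have Z r : chain r m.+1 w = false.
    by apply/negP => /chain_size; rewrite size_tuple; lia.
  by rewrite !Z.
have nE : n = m.*2.+1 + (n - m.*2.+1) by lia.
(* The suffix after the 2m+1 chain letters is shorter than n, so [IH] applies to it. *)
have : chain_tail_avoiding true m n T = chain_tail_avoiding false m n T.
  rewrite nE; apply: chain_tail_avoiding_eq => S; apply: IH; lia.
(* The terms for m+1 agree by [IHd] and cancel. *)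
rewrite !chain_tail_avoidingE // (IHd m.+1); last lia.
exact: addIn.
Qed.

Lemma avoiders_on_eq n S : avoiders_on true n S = avoiders_on false n S.
Proof.
elim/ltn_ind: n S => n IH S; rewrite !avoiders_on_chain.
by apply: chain_avoiding_eq => n' S' /IH.
Qed.

Lemma avoiders_sum r n :
  avoiders (pattern r) n k = \sum_(S : {set 'I_k}) avoiders_on r n S.
Proof.
rewrite /avoiders -sum1dep_card.
rewrite (partition_big (fun w : n.-tuple 'I_k => [set x in w]) xpredT) //=.
apply: eq_bigr => S _; rewrite /avoiders_on -sum1dep_card.
by apply: eq_bigl => w; rewrite avoids_pattern.
Qed.

End Words.

Theorem theorem3p2 :
  wilf_equivalent [tuple 1; 3; 2; 1] [tuple 1; 3; 2; 2].
Proof.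
move=> n k _; rewrite -/(pattern true) -/(pattern false) !avoiders_sum.
by apply: eq_bigr => S _; exact: avoiders_on_eq.
Qed.
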